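(* The (exponential) generating function of the Lah-Bell numbers is given by $$e^{\left(\frac{1}{1-t}-1\right)}=\sum_{n=0}^{\infty}B_{n}^{L}\frac{t^{n}}{n!},$$ as an identity of formal power series in $t$.
   Context: For integers $n,k\ge 0$, the unsigned Lah number $L(n,k)$ is the number of ways a set of $n$ elements can be partitioned into $k$ nonempty linearly ordered subsets (so $L(0,0)=1$, $L(n,0)=0$ for $n\ge 1$, $L(n,k)=0$ for $k>n$, and $L(n,k)=\binom{n-1}{k-1}\frac{n!}{k!}$ for $n\ge k\ge 1$). The $n$-th Lah-Bell number $B_n^L$ ($n\ge 0$) is the number of ways a set of $n$ elements can be partitioned into nonempty linearly ordered subsets, i.e. $B_n^L=\sum_{k=0}^n L(n,k)$. *)

(* Defs.v *)
From HB Require Import structures.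
From mathcomp Require Import all_boot all_order all_algebra.
Set Implicit Arguments. Unset Strict Implicit. Unset Printing Implicit Defensive.
Import GRing.Theory.

Section LahNumbers.

Variable T : finType.

(* r, a relation given by its graph, is a (non-strict) linear order on A;
   totality at x = y gives reflexivity. *)
Definition linear_order_on (A : {set T}) (r : {set T * T}) : bool :=
  [&& r \subset setX A A,
      [forall x in A, forall y in A, ((x, y) \in r) || ((y, x) \in r)],
      [forall x, forall y, ((x, y) \in r) && ((y, x) \in r) ==> (x == y)] &
      [forall x, forall y, forall z,
         ((x, y) \in r) && ((y, z) \in r) ==> ((x, z) \in r)]].

(* A block is a pair (A, r) of a subset and its order.  The library's partition
   already excludes the empty block; injectivity of fst on Q says that a subset
   carries a single order. *)
Definition ordered_partition (Q : {set {set T} * {set T * T}}) : bool :=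
  [&& [forall L in Q, linear_order_on L.1 L.2],
      dinjectiveb (fun L : {set T} * {set T * T} => L.1) (mem Q) &
      partition [set L.1 | L in Q] [set: T]].

Lemma ordered_partition_card Q : ordered_partition Q -> #|Q| <= #|T|.
Proof.
case/and3P=> _ /dinjectiveP injQ /and3P[/eqP cvQ trQ n0Q].
rewrite -(card_in_imset injQ) -cardsT -cvQ -(eqP trQ) -sum1_card.
apply: leq_sum => A QA; rewrite card_gt0.
by apply: contraNneq n0Q => <-.
Qed.

End LahNumbers.

Definition lah (n k : nat) : nat :=
  #|[set Q : {set {set 'I_n} * {set 'I_n * 'I_n}}
       | ordered_partition Q & #|Q| == k]|.

Definition lah_bell (n : nat) : nat :=
  #|[set Q : {set {set 'I_n} * {set 'I_n * 'I_n}} | ordered_partition Q]|.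

Lemma lah_bellE n : lah_bell n = \sum_(0 <= k < n.+1) lah n k.
Proof.
rewrite big_mkord /lah_bell -sum1_card.
rewrite (partition_big (fun Q : {set _} => inord #|Q| : 'I_n.+1) predT) //=.
apply: eq_bigr => k _; rewrite sum1_card; apply: eq_card => Q.
rewrite unfold_in !inE; case: (boolP (ordered_partition Q)) => //= opQ.
by rewrite -val_eqE /= inordK // ltnS -[leqRHS](card_ord n) ordered_partition_card.
Qed.

Local Open Scope ring_scope.

(* Formal power series are coefficient sequences; their equality is =1. *)
Section FormalPowerSeries.

Variable F : fieldType.

Definition fps := nat -> F.

Implicit Types f g : fps.

Definition fps_one : fps := fun n => (n == 0)%N%:R.

Definition fps_t : fps := fun n => (n == 1)%N%:R.

Definition fps_sub f g : fps := fun n => f n - g n.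

Definition fps_mul f g : fps := fun n => \sum_(i < n.+1) f i * g (n - i)%N.

Definition fps_pow f (k : nat) : fps := iter k (fps_mul f) fps_one.

(* The coefficients of 1/f of index at most n, computed by the recurrence
   g_n = - (1/f_0) * (f_1 g_(n-1) + ... + f_n g_0); meaningful for f_0 != 0. *)
Fixpoint fps_inv_seq f (n : nat) : seq F :=
  if n is m.+1 then
    let s := fps_inv_seq f m in
    rcons s (- (f 0%N)^-1 * \sum_(i < m.+1) f i.+1 * s`_(m - i))
  else [:: (f 0%N)^-1].

Definition fps_inv f : fps := fun n => (fps_inv_seq f n)`_n.

Lemma size_fps_inv_seq f n : size (fps_inv_seq f n) = n.+1.
Proof. by elim: n => //= n IHn; rewrite size_rcons IHn. Qed.

Lemma nth_fps_inv_seq f n i : (i <= n)%N -> (fps_inv_seq f n)`_i = fps_inv f i.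
Proof.
elim: n => [|n IHn]; first by rewrite leqn0 => /eqP->.
rewrite leq_eqVlt => /orP[/eqP-> // | lt_i].
by rewrite /= nth_rcons size_fps_inv_seq lt_i IHn.
Qed.

Lemma fps_mulfV f : f 0%N != 0 -> fps_mul f (fps_inv f) =1 fps_one.
Proof.
move=> f0 [|n]; rewrite /fps_mul /fps_one big_ord_recl subn0.
  by rewrite big_ord0 addr0 mulfV.
rewrite [X in _ * X]/fps_inv /= nth_rcons size_fps_inv_seq ltnn eqxx.
rewrite mulrA mulrN mulfV // mulN1r addrC; apply/eqP; rewrite subr_eq0; apply/eqP.
by apply: eq_bigr => i _; rewrite /bump /= add1n subSS nth_fps_inv_seq // leq_subr.
Qed.

(* Substitution g(f), for f without constant term: f^k then has no term of
   degree less than k, so only k <= n contribute to the coefficient of t^n. *)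
Definition fps_comp g f : fps :=
  fun n => \sum_(k < n.+1) g k * fps_pow f k n.

(* The series whose coefficient of t^n is a_n / n!. *)
Definition fps_egf (a : nat -> F) : fps := fun n => a n / n`!%:R.

(* The series e^t. *)
Definition fps_expt : fps := fps_egf (fun=> 1).

Definition fps_exp f : fps := fps_comp fps_expt f.

End FormalPowerSeries.

Arguments fps_one {F}.
Arguments fps_t {F}.

(* Main.v *)
Require Import Defs.
From HB Require Import structures.
From mathcomp Require Import all_boot all_order all_algebra.
From mathcomp Require Import ring.
Set Implicit Arguments. Unset Strict Implicit. Unset Printing Implicit Defensive.
Import GRing.Theory.

(** Write f = 1/(1-t) - 1 = t + t^2 + ... and let e_n be the coefficients of
exp f.  Differentiating exp f gives (exp f)' = f' * exp f, that is

   (n+1) e_(n+1) = sum_(i <= n) (i+1) e_(n-i)           ([fps_exp_rec]).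

The ordered partitions of a finite set satisfy the same recurrence. Fix x in a
set A with n+1 elements. An ordered partition of A amounts to the block B
containing x, a linear order on B, and an ordered partition of A \ B
([card_ordered_partitions_rec]). There are (i+1)! linear orders on a block of
i+1 elements ([card_linear_orders]), and C(n, i) subsets of A of this size
contain x; so, if b_m counts the ordered partitions of a set of m elements,

   b_(n+1) = sum_(i <= n) C(n, i) (i+1)! b_(n-i),

and dividing by n! shows that b_n / n! satisfies the recurrence of e_n.  Both
sequences start at 1, and the recurrence determines them in characteristic 0.

Both the orders and the partitions are counted by double counting: each of
them has exactly one distinguished part (the least element of the order, the
block through x), which is chosen first and then deleted. *)

Lemma card_bij_in (aT rT : finType) (A : {set aT}) (B : {set rT})
    (f : aT -> rT) (g : rT -> aT) :
  {in A, forall x, f x \in B} -> {in B, forall y, g y \in A} ->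
  {in A, cancel f g} -> {in B, cancel g f} -> #|A| = #|B|.
Proof.
move=> fAB gBA fK gK; rewrite -(card_in_imset (can_in_inj fK)).
congr #|pred_of_set _|; apply/setP=> y.
apply/imsetP/idP=> [[x Ax ->]|By]; first exact: fAB.
by exists (g y); rewrite ?gBA ?gK.
Qed.

(** * Linear orders on a finite set *)

Section LinearOrders.

Variable T : finType.
Implicit Types (A : {set T}) (r : {set T * T}).

Lemma linear_orderP A r :
  reflect [/\ r \subset setX A A,
              {in A &, forall x y, (x, y) \in r \/ (y, x) \in r},
              forall x y, (x, y) \in r -> (y, x) \in r -> x = y &
              forall x y z, (x, y) \in r -> (y, z) \in r -> (x, z) \in r]
          (linear_order_on A r).
Proof.
apply: (iffP and4P) => -[sub tot anti trans]; split=> //.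
- move=> x y Ax Ay; apply/orP.
  by move/forall_inP: tot => /(_ x Ax)/forall_inP/(_ y Ay).
- move=> x y rxy ryx; apply/eqP.
  by move/forallP: anti => /(_ x)/forallP/(_ y); rewrite rxy ryx.
- move=> x y z rxy ryz.
  by move/forallP: trans => /(_ x)/forallP/(_ y)/forallP/(_ z); rewrite rxy ryz.
- by apply/forall_inP=> x Ax; apply/forall_inP=> y Ay; apply/orP; apply: tot.
- by do 2![apply/forallP=> ?]; apply/implyP=> /andP[]; move=> ? ?; apply/eqP; apply: anti.
- by do 3![apply/forallP=> ?]; apply/implyP=> /andP[]; apply: trans.
Qed.

Definition linear_orders A := [set r | linear_order_on A r].

Definition above r x := [set y | (x, y) \in r].

(** An element with the largest number of elements above it is least: if y
were not above x, then y would be below x, and everything above x, as well as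
y itself, would be above y. *)
Lemma linear_order_least A r : linear_order_on A r -> A != set0 ->
  #|[set x in A | A \subset above r x]| = 1.
Proof.
move=> /linear_orderP[sub tot anti trans] /set0Pn[a Aa].
case: (@arg_maxnP _ a (fun x => x \in A) (fun x => #|above r x|) Aa) => x Ax max_x.
have low_x : A \subset above r x.
  apply/subsetP=> y Ay; rewrite inE; apply: contraT => rxy'.
  have ryx : (y, x) \in r by case: (tot x y Ax Ay) => // rxy; rewrite rxy in rxy'.
  have: above r x \proper above r y.
    apply/properP; split; first by apply/subsetP=> z; rewrite !inE; apply: trans.
    by exists y; rewrite inE //; case: (tot y y Ay Ay).
  by move/proper_card; rewrite ltnNge; case/negP; apply: max_x.
apply/eqP/cards1P; exists x; apply/setP=> y; rewrite !inE.
apply/andP/eqP=> [[Ay /subsetP low_y]|-> //].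
move: (low_y x Ax) (subsetP low_x y Ay); rewrite !inE; exact: anti.
Qed.

(** Deleting the least element x from an order on A is undone by putting x
below every element of A, itself included. *)
Lemma card_orders_with_least A x : x \in A ->
  #|[set r in linear_orders A | A \subset above r x]|
  = #|linear_orders (A :\ x)|.
Proof.
move=> Ax.
apply: (card_bij_in (f := fun r => r :&: setX (A :\ x) (A :\ x))
                    (g := fun r => setX [set x] A :|: r)).
- move=> r; rewrite !inE => /andP[/linear_orderP[sub tot anti trans] low].
  apply/linear_orderP; split; first exact: subsetIr.
  + move=> y z Ay Az; rewrite !in_setI !in_setX Ay Az !andbT.
    by apply: tot; [move: Ay | move: Az]; case/setD1P.
  + by move=> y z /setIP[ryz _] /setIP[rzy _]; apply: anti.
  + move=> y z t; rewrite !in_setI !in_setX => /and3P[ryz -> _] /and3P[rzt _ ->].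
    by rewrite !andbT; apply: trans rzt.
- move=> r; rewrite !inE => /linear_orderP[sub tot anti trans].
  have rA y z : (y, z) \in r -> [/\ y \in A, z \in A, y != x & z != x].
    by move/(subsetP sub); rewrite !inE /= => /andP[/andP[-> ->] /andP[-> ->]].
  apply/andP; split; last by apply/subsetP=> y Ay; rewrite !inE eqxx Ay.
  apply/linear_orderP; split.
  + apply/subsetP=> -[y z]; rewrite !inE /=.
    by case/orP=> [/andP[/eqP-> ->]|/rA[-> ->]] //; rewrite Ax.
  + move=> y z Ay Az; rewrite !inE /= Ay Az !andbT.
    case: eqVneq => [_|yx]; [by left|case: eqVneq => [_|zx]; [by right|]].
    by apply: tot; rewrite !inE ?yx ?zx.
  + move=> y z; rewrite !inE /=.
    case/orP=> [/andP[/eqP-> Az]|ryz] /orP[/andP[/eqP zx Ay]|rzy] //.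
    * by case/rA: rzy => _ _ _; rewrite eqxx.
    * by case/rA: ryz => _ _ _; rewrite zx eqxx.
    * exact: anti.
  + move=> y z t; rewrite !inE /=.
    case/orP=> [/andP[-> Az]|ryz] /orP[/andP[/eqP zx At]|rzt].
    * by rewrite At.
    * by case/rA: rzt => _ ->.
    * by case/rA: ryz => _ _ _; rewrite zx eqxx.
    * by rewrite (trans y z t) ?orbT.
- move=> r; rewrite !inE => /andP[/linear_orderP[sub tot anti trans] /subsetP low].
  apply/setP=> -[y z]; rewrite !inE /=.
  apply/orP/idP=> [[/andP[/eqP-> Az]|/andP[]//]|ryz]; first by have:= low z Az; rewrite inE.
  have:= subsetP sub _ ryz; rewrite inE /= => /andP[Ay Az].
  case: (eqVneq y x) => [_|yx]; [by left|right].
  rewrite ryz Ay Az /= andbT; apply: contraNneq yx => zx; apply/eqP.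
  apply: anti; first by rewrite -zx.
  by have:= low y Ay; rewrite inE.
- move=> r; rewrite inE => /linear_orderP[sub tot anti trans].
  apply/setP=> -[y z]; rewrite !inE /=.
  apply/andP/idP=> [[/orP[/andP[->]//|//]]|ryz].
  by have:= subsetP sub _ ryz; rewrite !inE /= ryz orbT.
Qed.

(** Classifying the orders on A by their least element gives n.+1 * n`! orders
on n.+1 elements. *)
Lemma card_linear_orders A : #|linear_orders A| = #|A|`!.
Proof.
move En: #|A| => n; elim: n A En => [|n IHn] A cardA.
  move/eqP: cardA; rewrite cards_eq0 => /eqP->.
  rewrite fact0; apply/eqP/cards1P; exists set0; apply/setP=> r; rewrite !inE.
  apply/linear_orderP/eqP=> [[sub _ _ _]|->].
    by apply/setP=> -[x y]; rewrite in_set0; apply/negP=> /(subsetP sub); rewrite !inE.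
  by split=> [|? ?|? ?|? ? ?]; rewrite ?sub0set // in_set0.
have A0 : A != set0 by rewrite -card_gt0 cardA.
(* Replace each 1 by the number of least elements of r. *)
rewrite -sum1_card.
rewrite (eq_bigr (fun r => \sum_(x in A | A \subset above r x) 1)); last first.
  move=> r; rewrite inE => lin_r; rewrite -[LHS](linear_order_least lin_r A0) -sum1_card.
  by apply: eq_bigl => x; rewrite inE.
rewrite (exchange_big_dep (mem A)) /=; last by move=> r x _ /andP[].
rewrite (eq_bigr (fun=> n`!)); first by rewrite sum_nat_const cardA factS.
move=> x Ax; rewrite -(IHn (A :\ x)); last by move: cardA; rewrite (cardsD1 x) Ax => -[].
rewrite -card_orders_with_least // -sum1_card; apply: eq_bigl => r.
by rewrite !inE Ax.
Qed.

End LinearOrders.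

(** * Ordered partitions of a finite set *)

Section OrderedPartitions.

Variable T : finType.
Implicit Types (A B : {set T}) (L : {set T} * {set T * T})
  (Q : {set {set T} * {set T * T}}).

Definition block_in A L := [&& linear_order_on L.1 L.2, L.1 != set0 & L.1 \subset A].

(** Ordered partitions of a subset A, so that blocks can be removed.  Asking for
a single block, carrying a single order, through each point of A replaces both
the disjointness of the blocks and the injectivity of [fst] on Q: two blocks
with a common point must be equal as pairs, and blocks are nonempty. *)
Definition ordered_partition_on A Q :=
  [forall L in Q, block_in A L]
  && [forall x in A, #|[set L in Q | x \in L.1]| == 1].

Lemma ordered_partition_onP A Q :
  reflect ({in Q, forall L, block_in A L} /\
           {in A, forall x, exists L, forall M, (M \in Q) && (x \in M.1) = (M == L)})
          (ordered_partition_on A Q).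
Proof.
apply: (iffP andP) => -[blk cov]; (split; first exact/forall_inP).
  move=> x /(forall_inP cov)/cards1P[L /setP QxL]; exists L => M.
  by have:= QxL M; rewrite !inE.
apply/forall_inP=> x /cov[L QxL]; apply/cards1P; exists L.
by apply/setP=> M; rewrite !inE QxL.
Qed.

(** In one direction a block through x is unique because blocks are disjoint
and their orders are determined by their underlying sets; in the other, any
two blocks that meet coincide. *)
Lemma ordered_partition_setT Q : ordered_partition Q = ordered_partition_on [set: T] Q.
Proof.
apply/and3P/ordered_partition_onP=> [[lin inj /and3P[/eqP cov triv n0]]|[blk cov]].
  split=> [L QL|x _].
    rewrite /block_in (forall_inP lin L QL) subsetT andbT /=.
    by apply: contraNneq n0 => <-; apply: imset_f.
  have : x \in cover [set L.1 | L in Q] by rewrite cov inE.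
  case/bigcupP=> _ /imsetP[L QL ->] Lx; exists L => M.
  apply/andP/eqP=> [[QM Mx]|-> //].
  move/dinjectiveP: inj; apply=> //.
  apply: contraTeq Lx => ML.
  have /trivIsetP/(_ M.1 L.1 (imset_f _ QM) (imset_f _ QL) ML) := triv.
  by move/disjointFr->.
split; first by apply/forall_inP=> L /blk/and3P[].
  apply/dinjectiveP=> L M QL QM eqLM; have /and3P[_ /set0Pn[x Lx] _] := blk L QL.
  have [N QN] := cov x (in_setT x).
  have /eqP-> : L == N by rewrite -QN QL.
  by apply/esym/eqP; rewrite -QN QM -eqLM.
apply/and3P; split.
- rewrite eqEsubset subsetT; apply/subsetP=> x Tx; have [L QL] := cov x Tx.
  have /andP[QL' Lx] : (L \in Q) && (x \in L.1) by rewrite QL.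
  by apply/bigcupP; exists L.1 => //; apply: imset_f.
- apply/trivIsetP=> _ _ /imsetP[L QL ->] /imsetP[M QM ->].
  apply: contraNT => /pred0Pn[x /andP[/= Lx Mx]].
  have [N QN] := cov x (in_setT x).
  have /eqP-> : L == N by rewrite -QN QL.
  by have /eqP-> : M == N by rewrite -QN QM.
- by apply/imsetP=> -[L /blk/and3P[_ + _] eqL]; rewrite -eqL eqxx.
Qed.

Lemma ordered_partitionU1 A L Q : block_in A L -> L \notin Q ->
  ordered_partition_on A (L |: Q) = ordered_partition_on (A :\: L.1) Q.
Proof.
move=> blkL QL; have /and3P[linL L0 sLA] := blkL.
apply/ordered_partition_onP/ordered_partition_onP=> -[blk cov]; split.
- move=> M QM; have /and3P[linM M0 sMA] := blk M (setU1r L QM).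
  rewrite /block_in linM M0 subsetD sMA /=.
  apply: contraNT QL => /pred0Pn[x /andP[/= Mx Lx]].
  have [N QN] := cov x (subsetP sLA x Lx).
  have /eqP-> : L == N by rewrite -QN setU11 Lx.
  by have /eqP<- : M == N by rewrite -QN setU1r.
- move=> x /setDP[Ax Lx]; have [N QN] := cov x Ax; exists N => M.
  rewrite -QN in_setU1; case: (eqVneq M L) => [->|_] //=.
  by rewrite (negPf Lx) andbF.
- move=> M /setU1P[-> //|/blk/and3P[linM M0]].
  by rewrite subsetD => /andP[sMA _]; apply/and3P.
- move=> x Ax; case: (boolP (x \in L.1)) => Lx.
    exists L => M; rewrite in_setU1; case: (eqVneq M L) => [->|_] //=.
    apply/andP=> -[/blk/and3P[_ _]]; rewrite subsetD => /andP[_ dis] Mx.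
    by rewrite (disjointFr dis Mx) in Lx.
  have [|N QN] := cov x; first by rewrite inE Lx.
  exists N => M; rewrite -QN in_setU1; case: (eqVneq M L) => [->|_] //=.
  by rewrite (negPf Lx) andbF.
Qed.

(** A given block L can be removed and put back: a nonempty L cannot occur among
the blocks of a partition of A :\: L.1. *)
Lemma card_ordered_partitions_block A L : block_in A L ->
  #|[set Q | ordered_partition_on A Q & L \in Q]|
  = #|[set Q | ordered_partition_on (A :\: L.1) Q]|.
Proof.
move=> blkL; have newL Q : ordered_partition_on (A :\: L.1) Q -> L \notin Q.
  have /and3P[_ /set0Pn[x Lx] _] := blkL.
  case/ordered_partition_onP=> blk _; apply/negP=> /blk/and3P[_ _ /subsetP/(_ x Lx)].
  by rewrite inE Lx.
apply: (card_bij_in (f := fun Q => Q :\ L) (g := fun Q => L |: Q)) => Q; rewrite !inE.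
- case/andP=> opQ QL; rewrite -(ordered_partitionU1 blkL) ?setD1K //.
  by rewrite !inE eqxx.
- by move=> opQ; rewrite ordered_partitionU1 ?newL // opQ eqxx.
- by case/andP=> _ /setD1K.
- by move/newL/setU1K.
Qed.

(** Each ordered partition of A has exactly one block through x; summing over
that block, first over its underlying set B and then over its #|B|`! orders,
leaves an arbitrary ordered partition of A :\: B. *)
Lemma card_ordered_partitions_rec A x : x \in A ->
  #|[set Q | ordered_partition_on A Q]|
  = \sum_(B : {set T} | (x \in B) && (B \subset A))
      #|B|`! * #|[set Q | ordered_partition_on (A :\: B) Q]|.
Proof.
move=> Ax; pose blockx L := block_in A L && (x \in L.1).
have blockxE L : blockx L = ((x \in L.1) && (L.1 \subset A)) && linear_order_on L.1 L.2.
  rewrite /blockx /block_in; case: (boolP (x \in L.1)) => [Lx|_]; last by rewrite andbF.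
  have -> : L.1 != set0 by apply/set0Pn; exists x.
  by rewrite andbT andbC.
(* Replace each 1 by the number of blocks of Q through x. *)
transitivity (\sum_(L | blockx L) #|[set Q | ordered_partition_on (A :\: L.1) Q]|).
  rewrite -sum1_card (eq_bigr (fun Q => \sum_(L in Q | x \in L.1) 1)); last first.
    move=> Q; rewrite inE => /andP[_ /forall_inP/(_ x Ax)/eqP Qx].
    by rewrite -[LHS]Qx -sum1_card; apply: eq_bigl => L; rewrite inE.
  rewrite (exchange_big_dep blockx) /=; last first.
    move=> Q L; rewrite inE => /ordered_partition_onP[blk _] /andP[QL Lx].
    by rewrite /blockx blk.
  apply: eq_bigr => L /andP[blkL Lx].
  rewrite -card_ordered_partitions_block // -sum1_card.
  by apply: eq_bigl => Q; rewrite !inE Lx andbT.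
rewrite (eq_bigl _ _ blockxE).
rewrite -(pair_big_dep (fun B => (x \in B) && (B \subset A)) (fun B r => linear_order_on B r)
  (fun B r => #|[set Q | ordered_partition_on (A :\: B) Q]|)) /=.
apply: eq_bigr => B _; rewrite sum_nat_const -card_linear_orders.
by congr (_ * _); apply: eq_card => r; rewrite inE.
Qed.

Lemma ordered_partitions_set0 : #|[set Q | ordered_partition_on set0 Q]| = 1.
Proof.
apply/eqP/cards1P; exists set0; apply/setP=> Q; rewrite !inE.
apply/ordered_partition_onP/eqP=> [[blk _]|->]; last by split=> ?; rewrite inE.
apply/eqP; rewrite -subset0; apply/subsetP=> L /blk/and3P[_ L0].
by rewrite subset0 (negPf L0).
Qed.

End OrderedPartitions.

Local Open Scope ring_scope.

(** * The exponential of a formal power series *)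

Section ExponentialOfSeries.

Variable F : fieldType.
Implicit Types f g : fps F.

(** The coefficients of degree less than N of a product depend only on those
of its factors, so powers of series can be computed on truncated polynomials,
where ring arithmetic and derivatives are available. *)
Lemma fps_pow_trunc f N k m : (m < N)%N ->
  fps_pow f k m = ((\poly_(i < N) f i) ^+ k)`_m.
Proof.
elim: k m => [|k IHk] m ltmN; first by rewrite expr0 coef1.
rewrite exprS coefM; apply: eq_bigr => i _.
have leim : (i <= m)%N by rewrite -ltnS.
rewrite coef_poly (leq_ltn_trans leim ltmN) -IHk //.
by rewrite (leq_ltn_trans (leq_subr _ _)).
Qed.

Lemma fps_pow_low f k m : f 0%N = 0 -> (m < k)%N -> fps_pow f k m = 0.
Proof.
move=> f0; elim: k m => // k IHk m ltmk.
rewrite /fps_pow iterS {1}/fps_mul big1 // => -[[|i] lti] _ /=; first by rewrite f0 mul0r.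
rewrite -/(fps_pow f k) IHk ?mulr0 //.
case: m ltmk lti => // m ltmk _; rewrite subSS.
by rewrite (leq_ltn_trans (leq_subr _ _)).
Qed.

(** Powers f^k with m < k do not contribute to degree m, so the length of the
exponential sum may be made independent of m; it is then a polynomial. *)
Lemma fps_exp_trunc f N m : f 0%N = 0 -> (m < N)%N ->
  fps_exp f m = (\sum_(k < N) k`!%:R^-1 *: (\poly_(i < N) f i) ^+ k)`_m.
Proof.
move=> f0 ltmN; rewrite coef_sum /fps_exp /fps_comp.
rewrite (big_ord_widen N (fun k => fps_expt F k * fps_pow f k m)) // big_mkcond.
apply: eq_bigr => k _; rewrite coefZ -fps_pow_trunc // /fps_expt /fps_egf div1r.
by case: ltnP => // ltmk; rewrite fps_pow_low ?mulr0.
Qed.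

(** The coefficient form of (exp f)' = f' * exp f, obtained by differentiating
the exponential sum truncated at degree n.+1.  Characteristic 0 is what makes
k / k`! equal to 1 / (k-1)`!. *)
Lemma fps_exp_rec f n : [pchar F] =i pred0 -> f 0%N = 0 ->
  n.+1%:R * fps_exp f n.+1 = \sum_(i < n.+1) i.+1%:R * f i.+1 * fps_exp f (n - i)%N.
Proof.
move=> /GRing.pcharf0P charF0 f0; set p := \poly_(i < n.+2) f i.
have dE : (\sum_(k < n.+2) k`!%:R^-1 *: p ^+ k)^`()
    = p^`() * \sum_(k < n.+1) k`!%:R^-1 *: p ^+ k.
  rewrite raddf_sum /= big_ord_recl derivZ expr0 -polyC1 derivC scaler0 add0r mulr_sumr.
  apply: eq_bigr => k _; rewrite derivZ deriv_exp /= -scaler_nat -scalerAr scalerA.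
  rewrite /bump /= add1n factS natrM; congr (_ *: _).
  by rewrite invfM mulrAC mulVf ?mul1r ?charF0.
rewrite mulr_natl (@fps_exp_trunc f n.+2) // -coef_deriv dE coefM.
apply: eq_bigr => i _; rewrite coef_deriv coef_poly !ltnS mulr_natl.
have lein := ltn_ord i; rewrite ltnS in lein; rewrite lein; congr (_ * _).
rewrite (@fps_exp_trunc f n.+2) ?ltnS ?(leq_trans (leq_subr _ _)) //.
(* The sum on the right has the extra term f^(n.+1), which starts in a degree
   greater than n - i. *)
rewrite [in RHS]big_ord_recr coefD coefZ /= -/p.
rewrite -fps_pow_trunc ?ltnS ?(leq_trans (leq_subr _ _)) //.
by rewrite fps_pow_low ?mulr0 ?addr0 ?ltnS ?leq_subr.
Qed.

(** The equation (1 - t) * g = 1 says that consecutive coefficients of g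
agree, from g_0 = 1 on. *)
Lemma fps_inv_1subt n : fps_inv (fps_sub fps_one fps_t) n = 1 :> F.
Proof.
set g : fps F := fps_sub fps_one fps_t.
have g0 : g 0%N = 1 by rewrite /g /fps_sub /fps_one /fps_t subr0.
have gV := fps_mulfV (etrans (congr1 (fun c => c != 0) g0) (oner_neq0 F)).
elim: n => [|n IHn]; first by rewrite /fps_inv /= g0 invr1.
have := gV n.+1; rewrite /fps_mul !big_ord_recl subn0 big1 => [|i _]; last first.
  by rewrite /g /fps_sub /fps_one /fps_t subrr mul0r.
rewrite g0 mul1r addr0 /bump /= subSS subn0 IHn.
rewrite /g /fps_sub /fps_one /fps_t /= add0r mulr1 => /eqP.
by rewrite subr_eq0 => /eqP.
Qed.

End ExponentialOfSeries.

(** * The generating function *)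

(** The recurrence on e is that of the derivative of exp (t / (1 - t)); by
induction on #|A|, it is the block recurrence divided by factorials. *)
Lemma ordered_partitions_egf (F : fieldType) (T : finType) (e : nat -> F) :
  e 0%N = 1 ->
  (forall n, n.+1%:R * e n.+1 = \sum_(i < n.+1) i.+1%:R * e (n - i)%N) ->
  forall A : {set T},
    #|[set Q | ordered_partition_on A Q]|%:R = #|A|`!%:R * e #|A|.
Proof.
move=> e0 e_rec A; move En: #|A| => n.
elim/ltn_ind: n A En => -[|n] IHn A cardA.
  move/eqP: cardA; rewrite cards_eq0 => /eqP->.
  by rewrite ordered_partitions_set0 e0 mulr1.
have /set0Pn[x Ax] : A != set0 by rewrite -card_gt0 cardA.
have cardAx : #|A :\ x| = n by move: cardA; rewrite (cardsD1 x) Ax => -[].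
rewrite (card_ordered_partitions_rec Ax) natr_sum.
have cardC (C : {set T}) : C \subset A :\ x -> #|A :\: C| = (n.+1 - #|C|)%N.
  by rewrite subsetD1 => /andP[/setIidPr CA _]; rewrite cardsD CA cardA.
(* Sum over the complement C of the block of x, a subset of A :\ x. *)
rewrite (reindex_onto (fun C => A :\: C) (fun B => A :\: B)) /=; last first.
  by move=> B /andP[_ BA]; rewrite setDDr setDv set0U; apply/setIidPr.
rewrite (eq_bigl (fun C : {set T} => C \subset A :\ x)); last first.
  move=> C; rewrite subsetDl andbT inE Ax andbT setDDr setDv set0U.
  by rewrite subsetD1 andbC; congr (_ && _); apply/eqP/setIidPr.
(* Group the C by size; the term of index j of the recurrence corresponds to
   #|C| = n - j, whence the reversal of indices. *)
rewrite (partition_big (fun C : {set T} => inord #|C| : 'I_n.+1) xpredT) //=.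
rewrite factS natrM mulrAC e_rec mulr_suml (reindex_inj rev_ord_inj) /=.
apply: eq_bigr => j _.
have lejn : (j <= n)%N by rewrite -ltnS.
rewrite (eq_bigr (fun=> (j.+1)`!%:R * ((n - j)`!%:R * e (n - j)%N))); last first.
  move=> C /andP[CAx /eqP/(congr1 val)]; rewrite /= subSS inordK; last first.
    by rewrite ltnS -cardAx subset_leq_card.
  move=> cC; have := CAx; rewrite subsetD1 => /andP[/setIidPr CA _].
  rewrite natrM cardC // setDDr setDv set0U CA cC (IHn _ _ _ cC) ?ltnS ?subSS ?leq_subr //.
  by rewrite subSn ?leq_subr // subKn.
rewrite sumr_const.
have -> : #|[pred C : {set T} | (C \subset A :\ x) && (inord #|C| == rev_ord j)]|
    = 'C(n, j).
  rewrite -bin_sub //; have := cards_draws (A :\ x) (n - j)%N; rewrite cardAx => <-.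
  apply: eq_card => C; rewrite !inE.
  case: (boolP (C \subset A :\ x)) => //= CAx.
  by rewrite -val_eqE /= inordK ?subSS // ltnS -cardAx subset_leq_card.
rewrite -(bin_fact lejn) factS !natrM -mulr_natl.
ring.
Qed.

Theorem lemma1 (F : fieldType) (charF0 : [pchar F] =i pred0) :
  @fps_exp F (fps_sub (fps_inv (fps_sub fps_one fps_t)) fps_one)
    =1 fps_egf (fun n : nat => (lah_bell n)%:R : F).
Proof.
set u := fps_sub _ _.
have uE n : u n = (n != 0)%N%:R.
  by rewrite /u {1}/fps_sub fps_inv_1subt /fps_one; case: n => [|n]; rewrite ?subrr ?subr0.
have u0 : u 0%N = 0 by rewrite uE.
move=> n; rewrite /fps_egf /lah_bell; have /GRing.pcharf0P charF := charF0.
have -> : [set Q : {set {set 'I_n} * {set 'I_n * 'I_n}} | ordered_partition Q]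
    = [set Q | ordered_partition_on [set: 'I_n] Q].
  by apply/setP=> Q; rewrite !inE ordered_partition_setT.
rewrite (@ordered_partitions_egf F _ (fps_exp u)).
- by rewrite cardsT card_ord mulrAC mulfV ?mul1r // charF -lt0n fact_gt0.
- rewrite /fps_exp /fps_comp big_ord_recl big_ord0.
  by rewrite /fps_expt /fps_egf /fps_pow /fps_one /= divr1 mulr1 addr0.
- move=> m; rewrite fps_exp_rec //; apply: eq_bigr => i _.
  by rewrite uE mulr1.
Qed.
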